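(* Let $\mathbf{A}$ and $\mathbf{B}$ be thin categories with the same object set $S$, and let $T\subseteq S^3$ be the set of all triples $(x,y,z)$ such that ${}_xB_y\times{}_yA_z$ is not empty. If $R=\{{}_xR_z^y\}_{x,y,z\in S}$ is a twisting system between $\mathbf{B}$ and $\mathbf{A}$, then there exists a function $|\cdots|:S^3\to S$ which induces $R$ and satisfies, for all $x,y,z,t\in S$: (i) if $(y,z,t)\in T$ and $(x,y,|yzt|)\in T$, then $|xy|yzt||=|xzt|$; (ii) if $(x,y,z)\in T$ and $(|xyz|,z,t)\in T$, then $||xyz|zt|=|xyt|$; (iii) if $(x,x,y)\in T$, then $|xxy|=y$; (iv) if $(x,y,y)\in T$, then $|xyy|=x$; (v) if $(x,y,z)\in T$, then ${}_xA_{|xyz|}\times{}_{|xyz|}B_z$ is not empty. Conversely, every function $|\cdots|:S^3\to S$ satisfying (i)-(v) induces a twisting system between $\mathbf{B}$ and $\mathbf{A}$. Two such functions $|\cdots|$ and $|\cdots|'$ induce the same twisting system if and only if their restrictions to $T$ are equal.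
   Context: Categories here are ordinary small categories. For a category $\mathbf{A}$ with object set $S$, ${}_xA_y$ denotes the set of morphisms from $y$ to $x$, so composition is a map ${}_xA_y\times{}_yA_z\to{}_xA_z$, $(g,g')\mapsto g\circ g'$; $1_x^A$ is the identity of $x$. Similarly for $\mathbf{B}$. A category is thin if there is at most one morphism between any two objects; a nonempty ${}_xA_y$ is written $\{{}_xg_y\}$ and a nonempty ${}_xB_y$ is written $\{{}_xf_y\}$. A twisting system between $\mathbf{B}$ and $\mathbf{A}$ is a family of maps ${}_xR_z^y:{}_xB_y\times{}_yA_z\to\coprod_{u\in S}{}_xA_u\times{}_uB_z$ (disjoint union) such that for all $x,y,z,t\in S$: (T1) for $(f,f',g)\in{}_xB_y\times{}_yB_z\times{}_zA_t$: if ${}_yR_t^z(f',g)=(g_1,f_1)\in{}_yA_u\times{}_uB_t$ and ${}_xR_u^y(f,g_1)=(g_2,f_2)\in{}_xA_v\times{}_vB_u$, then ${}_xR_t^z(f\circ f',g)=(g_2,f_2\circ f_1)\in{}_xA_v\times{}_vB_t$; (T2) for $(f,g,g')\in{}_xB_y\times{}_yA_z\times{}_zA_t$: if ${}_xR_z^y(f,g)=(g_1,f_1)\in{}_xA_v\times{}_vB_z$ and ${}_vR_t^z(f_1,g')=(g_2,f_2)\in{}_vA_u\times{}_uB_t$, then ${}_xR_t^y(f,g\circ g')=(g_1\circ g_2,f_2)\in{}_xA_u\times{}_uB_t$; (T3) ${}_xR_y^x(1_x^B,g)=(g,1_y^B)\in{}_xA_y\times{}_yB_y$ for $g\in{}_xA_y$;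 (T4) ${}_xR_y^y(f,1_y^A)=(1_x^A,f)\in{}_xA_x\times{}_xB_y$ for $f\in{}_xB_y$. The function $|\cdots|$ induces $R$ (for thin $\mathbf{A},\mathbf{B}$) means: for $(x,y,z)\in T$, ${}_xR_z^y({}_xf_y,{}_yg_z)=({}_xg_{|xyz|},{}_{|xyz|}f_z)\in{}_xA_{|xyz|}\times{}_{|xyz|}B_z$; for $(x,y,z)\notin T$, ${}_xR_z^y$ is the empty function. *)

(* Defs.v *)
Set Implicit Arguments.
Unset Strict Implicit.
Unset Printing Implicit Defensive.

(* [hom C x y] is the set of morphisms from y to x, so that [comp g g']
   is the composite g o g' and the indices compose from left to right. *)
Record category (S : Type) : Type := Category {
  hom :> S -> S -> Type;
  idm : forall x, hom x x;
  comp : forall x y z, hom x y -> hom y z -> hom x z;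
  comp_id_l : forall x y (g : hom x y), comp (idm x) g = g;
  comp_id_r : forall x y (g : hom x y), comp g (idm y) = g;
  comp_assoc : forall x y z t (g : hom x y) (g' : hom y z) (g'' : hom z t),
    comp (comp g g') g'' = comp g (comp g' g'')
}.

Arguments idm {S} c x.

Definition thin (S : Type) (C : category S) : Prop :=
  forall (x y : S) (g g' : C x y), g = g'.

(* The disjoint union over u of A x u * B u z. *)
Definition factorization (S : Type) (A B : category S) (x z : S) : Type :=
  {u : S & (A x u * B u z)%type}.

Definition fact (S : Type) (A B : category S) (x u z : S)
    (g : A x u) (f : B u z) : factorization A B x z :=
  existT (fun u => (A x u * B u z)%type) u (g, f).

(* [R x y z] is the map with lower indices x, z and upper index y. *)
Definition twisting_family (S : Type) (A B : category S) : Type :=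
  forall x y z : S, B x y -> A y z -> factorization A B x z.

Record twisting_system (S : Type) (A B : category S)
    (R : twisting_family A B) : Prop := TwistingSystem {
  twist_compB : forall x y z t (f : B x y) (f' : B y z) (g : A z t)
      u (g1 : A y u) (f1 : B u t) v (g2 : A x v) (f2 : B v u),
    R y z t f' g = fact g1 f1 ->
    R x y u f g1 = fact g2 f2 ->
    R x z t (comp f f') g = fact g2 (comp f2 f1);
  twist_compA : forall x y z t (f : B x y) (g : A y z) (g' : A z t)
      v (g1 : A x v) (f1 : B v z) u (g2 : A v u) (f2 : B u t),
    R x y z f g = fact g1 f1 ->
    R v z t f1 g' = fact g2 f2 ->
    R x y t f (comp g g') = fact (comp g1 g2) f2;
  twist_idB : forall x y (g : A x y), R x x y (idm B x) g = fact g (idm B y);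
  twist_idA : forall x y (f : B x y), R x y y f (idm A y) = fact (idm A x) f
}.

Definition composable (S : Type) (A B : category S) (x y z : S) : Prop :=
  inhabited (B x y * A y z).

(* For thin A and B the morphisms g and f below are unique when they exist.
   Off [composable A B] the domain of [R x y z] is empty, so that R x y z is
   the empty function and there is nothing to require. *)
Definition induces (S : Type) (A B : category S) (m : S -> S -> S -> S)
    (R : twisting_family A B) : Prop :=
  forall x y z, composable A B x y z ->
  forall (f0 : B x y) (g0 : A y z),
  exists (g : A x (m x y z)) (f : B (m x y z) z), R x y z f0 g0 = fact g f.

Record twisting_function (S : Type) (A B : category S)
    (m : S -> S -> S -> S) : Prop := TwistingFunction {
  twfun_compB : forall x y z t,
    composable A B y z t -> composable A B x y (m y z t) ->
    m x y (m y z t) = m x z t;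
  twfun_compA : forall x y z t,
    composable A B x y z -> composable A B (m x y z) z t ->
    m (m x y z) z t = m x y t;
  twfun_idB : forall x y, composable A B x x y -> m x x y = y;
  twfun_idA : forall x y, composable A B x y y -> m x y y = x;
  twfun_fact : forall x y z, composable A B x y z ->
    inhabited (A x (m x y z) * B (m x y z) z)
}.

(* Main.v *)
(** A morphism of a thin category is determined by its endpoints, so an element
    of the disjoint union of the [A x u * B u z] is determined by its middle
    index [u]. Hence [R x y z f g = fact g1 f1] says only that the middle index
    is [m x y z], and the axioms of twisting systems become (i)-(iv), with (v)
    expressing that the required factorizations exist. *)

Require Import Defs.
From Stdlib Require Import ClassicalEpsilon FunctionalExtensionality.

Lemma thin_fact_eq (S : Type) (A B : category S) (thinA : thin A)
    (thinB : thin B) x z u u' (g : A x u) (f : B u z) (g' : A x u')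
    (f' : B u' z) : u = u' -> fact g f = fact g' f'.
Proof.
  intros e; destruct e.
  now rewrite (thinA _ _ g g'), (thinB _ _ f f').
Qed.

(** The bridge between the two sides: it turns each equation between values of [R] into an equation
    in [S]. Forwards it compares first projections; backwards it uses thinness. *)
Lemma induces_fact_iff (S : Type) (A B : category S) (thinA : thin A)
    (thinB : thin B) (m : S -> S -> S -> S) (R : twisting_family A B) :
  induces m R -> forall x y z (f : B x y) (g : A y z) u (g1 : A x u) (f1 : B u z),
  R x y z f g = fact g1 f1 <-> u = m x y z.
Proof.
  intros mR x y z f g u g1 f1.
  destruct (mR x y z (inhabits (f, g)) f g) as (g2 & f2 & ->).
  split; intros e.
  - exact (eq_sym (f_equal (@projT1 _ _) e)).
  - now apply thin_fact_eq.
Qed.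

Lemma thin_twisting_family_induced (S : Type) (A B : category S)
    (thinA : thin A) (thinB : thin B) (R : twisting_family A B) :
  exists m, induces m R.
Proof.
  pose (P x y z u := forall (f0 : B x y) (g0 : A y z),
          exists (g : A x u) (f : B u z), R x y z f0 g0 = fact g f).
  (* Off [composable A B], [P x y z] holds vacuously for every index, so any value will do there;
     [x] only shows that [S] is inhabited. *)
  exists (fun x y z => epsilon (inhabits x) (P x y z)).
  intros x y z [[f0 g0]]; change (P x y z (epsilon (inhabits x) (P x y z))).
  apply epsilon_spec.
  (* The middle index at one pair serves for all, since by thinness there is only one pair. *)
  exists (projT1 (R x y z f0 g0)); intros f0' g0'.
  rewrite (thinB _ _ f0' f0), (thinA _ _ g0' g0).
  destruct (R x y z f0 g0) as [u [g f]]; now exists g, f.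
Qed.

Lemma twisting_function_induces (S : Type) (A B : category S)
    (m : S -> S -> S -> S) :
  twisting_function A B m -> exists R : twisting_family A B, induces m R.
Proof.
  intros tm.
  (* Condition (v) only asserts [inhabited], so [epsilon] with the trivial predicate extracts an
     actual pair of morphisms through [m x y z]. *)
  exists (fun x y z f g => existT (fun u => (A x u * B u z)%type) (m x y z)
    (epsilon (twfun_fact tm (inhabits (f, g))) (fun _ => True))).
  intros x y z _ f g.
  destruct (epsilon _ _) as [g1 f1]; now exists g1, f1.
Qed.

Lemma twisting_system_iff_function (S : Type) (A B : category S)
    (thinA : thin A) (thinB : thin B) (m : S -> S -> S -> S)
    (R : twisting_family A B) :
  induces m R -> (twisting_system R <-> twisting_function A B m).
Proof.
  intros mR.
  pose proof (induces_fact_iff _ _ _ thinA thinB _ _ mR) as factE.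
  split; intros H; split.
  (* The morphism of [A y (m y z t)] is taken to be [g1], produced by [R], so that [e1] and [e2] are
     the premises of (T1); its conclusion has middle index [m x y (m y z t)]. *)
  - intros x y z t [[f' g]] [[f _]].
    destruct (mR y z t (inhabits (f', g)) f' g) as (g1 & f1 & e1).
    destruct (mR x y _ (inhabits (f, g1)) f g1) as (g2 & f2 & e2).
    exact (proj1 (factE _ _ _ _ _ _ _ _) (twist_compB H e1 e2)).
  - intros x y z t [[f g]] [[_ g']].
    destruct (mR x y z (inhabits (f, g)) f g) as (g1 & f1 & e1).
    destruct (mR _ z t (inhabits (f1, g')) f1 g') as (g2 & f2 & e2).
    exact (proj1 (factE _ _ _ _ _ _ _ _) (twist_compA H e1 e2)).
  - intros x y [[_ g]].
    symmetry; exact (proj1 (factE _ _ _ _ _ _ _ _) (twist_idB H g)).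
  - intros x y [[f _]].
    symmetry; exact (proj1 (factE _ _ _ _ _ _ _ _) (twist_idA H f)).
  - intros x y z [[f g]].
    destruct (mR x y z (inhabits (f, g)) f g) as (g1 & f1 & _).
    exact (inhabits (g1, f1)).
  (* Once [u] and [v] are replaced by values of [m], the given morphisms themselves witness the
     membership in [T] required by (i). *)
  - intros x y z t f f' g u g1 f1 v g2 f2 e1%factE e2%factE; subst u v.
    apply factE, (twfun_compB H); [exact (inhabits (f', g)) | exact (inhabits (f, g1))].
  - intros x y z t f g g' v g1 f1 u g2 f2 e1%factE e2%factE; subst v u.
    apply factE, (twfun_compA H); [exact (inhabits (f, g)) | exact (inhabits (f1, g'))].
  - intros x y g.
    apply factE; symmetry; exact (twfun_idB H (inhabits (idm B x, g))).
  - intros x y f.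
    apply factE; symmetry; exact (twfun_idA H (inhabits (f, idm A y))).
Qed.

Lemma induces_eq_iff (S : Type) (A B : category S) (thinA : thin A)
    (thinB : thin B) (m m' : S -> S -> S -> S) (R R' : twisting_family A B) :
  induces m R -> induces m' R' ->
  (R = R' <-> forall x y z, composable A B x y z -> m x y z = m' x y z).
Proof.
  intros mR mR'; split.
  - intros <- x y z [[f g]].
    destruct (mR x y z (inhabits (f, g)) f g) as (g1 & f1 & e).
    exact (proj1 (induces_fact_iff _ _ _ thinA thinB _ _ mR' _ _ _ _ _ _ _ _) e).
  - intros e.
    (* Any arguments [f], [g] already place the triple in [T], so agreement there determines the
       whole family. *)
    extensionality x; extensionality y; extensionality z.
    extensionality f; extensionality g.
    destruct (mR x y z (inhabits (f, g)) f g) as (g1 & f1 & ->).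
    symmetry; apply (induces_fact_iff _ _ _ thinA thinB _ _ mR').
    exact (e x y z (inhabits (f, g))).
Qed.

Theorem theorem4p9 (S : Type) (A B : category S)
    (thinA : thin A) (thinB : thin B) :
  (forall R : twisting_family A B, twisting_system R ->
     exists m : S -> S -> S -> S, induces m R /\ twisting_function A B m)
  /\
  (forall m : S -> S -> S -> S, twisting_function A B m ->
     exists R : twisting_family A B, twisting_system R /\ induces m R)
  /\
  (forall m m' : S -> S -> S -> S,
     twisting_function A B m -> twisting_function A B m' ->
     forall R R' : twisting_family A B,
     twisting_system R -> induces m R ->
     twisting_system R' -> induces m' R' ->
     (R = R' <->
      forall x y z, composable A B x y z -> m x y z = m' x y z)).
Proof.
  split; [|split].
  - intros R tR.
    destruct (thin_twisting_family_induced _ _ _ thinA thinB R) as [m mR].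
    exists m; split; [exact mR|].
    now apply (twisting_system_iff_function _ _ _ thinA thinB _ _ mR).
  - intros m tm.
    destruct (twisting_function_induces _ _ _ _ tm) as [R mR].
    exists R; split; [|exact mR].
    now apply (twisting_system_iff_function _ _ _ thinA thinB _ _ mR).
  - intros m m' _ _ R R' _ mR _ mR'.
    exact (induces_eq_iff _ _ _ thinA thinB _ _ _ _ mR mR').
Qed.
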